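(* There exists an absolute constant $C$ such that the following holds. Let $n\ge 7$ and let $G$ be a graph on $n$ vertices with average degree $d\le \frac{3n}{8}-C$. Then for every integer $r\ge 1$, the $K_r$-count $\mathrm{k}_r(G)$ is reconstructible from $n-1$ cards.
   Context: Graphs are finite and simple. For a graph $G$ and $v\in V(G)$, the card $G-v$ is the unlabelled induced subgraph $G[V(G)\setminus\{v\}]$ (i.e. considered up to isomorphism). The deck $\mathcal{D}(G)$ is the multiset of all cards $G-v$, $v\in V(G)$. The $K_r$-count $\mathrm{k}_r(G)$ is the number of $r$-element vertex subsets of $G$ that induce a complete graph. A quantity $f(G)$ of an $n$-vertex graph $G$ is reconstructible from $n-1$ cards if for every graph $H$ which has at least $n-1$ cards in common with $G$ (decks compared as multisets of isomorphism classes) we have $f(H)=f(G)$. *)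

(* Defs.v *)
From mathcomp Require Import all_boot all_order all_algebra.
From mathcomp Require Import finmap multiset.

Set Implicit Arguments.
Unset Strict Implicit.
Unset Printing Implicit Defensive.

Import Order.TTheory GRing.Theory Num.Theory.

Record sgraph := SGraph {
  vertex :> finType;
  adj : rel vertex;
  adj_sym : symmetric adj;
  adj_irrefl : irreflexive adj
}.
Arguments adj {s}.

Definition induced_adj (G : sgraph) (S : {set G}) : rel {x : G | x \in S} :=
  [rel x y | adj (val x) (val y)].

Fact induced_sym (G : sgraph) (S : {set G}) : symmetric (@induced_adj G S).
Proof. by move=> x y; apply: adj_sym. Qed.

Fact induced_irrefl (G : sgraph) (S : {set G}) : irreflexive (@induced_adj G S).
Proof. by move=> x; apply: adj_irrefl. Qed.

Definition induced (G : sgraph) (S : {set G}) : sgraph :=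
  SGraph (@induced_sym G S) (@induced_irrefl G S).

Definition isomorphic (G H : sgraph) : Prop :=
  exists2 f : G -> H, bijective f & forall x y, adj (f x) (f y) = adj x y.

(* An isomorphism class of graphs is encoded as its number k of vertices
   together with the set of all adjacency matrices of its members on the vertex
   set 'I_k; see unlabelledP. The domain size k of [labellings] is a separate
   argument to avoid casts, but is meant to be #|G|. *)
Definition labellings (k : nat) (G : sgraph) : {set 'M[bool]_k} :=
  [set (\matrix_(i, j) adj (f i) (f j))%R | f : {ffun 'I_k -> G} & injectiveb f].

Definition ugraph : choiceType := {k : nat & {set 'M[bool]_k}}.

Definition unlabelled (G : sgraph) : ugraph :=
  Tagged (fun k => {set 'M[bool]_k}) (labellings #|G| G).

Lemma unlabelledP (G H : sgraph) :
  unlabelled G = unlabelled H <-> isomorphic G H.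
Proof.
split=> [eqGH | [f bij_f adj_f]].
- have cGH : #|G| = #|H| := congr1 tag eqGH.
  move: eqGH; rewrite /unlabelled -cGH => /eqP; rewrite eq_Tagged /= => /eqP eqL.
  pose e := [ffun i : 'I_#|G| => enum_val i].
  have inj_e : injectiveb e.
    by apply/injectiveP => i j; rewrite !ffunE => /enum_val_inj.
  have : (\matrix_(i, j) adj (e i) (e j))%R \in labellings #|G| G.
    by apply/imsetP; exists e; rewrite ?inE.
  rewrite eqL => /imsetP[f]; rewrite inE => /injectiveP inj_f /matrixP eq_ef.
  exists (fun x => f (enum_rank x)).
    apply: inj_card_bij; last by rewrite cGH.
    by move=> x y /inj_f /enum_rank_inj.
  by move=> x y; move: (eq_ef (enum_rank x) (enum_rank y));
    rewrite !mxE !ffunE !enum_rankK.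
- have cGH := bij_eq_card bij_f.
  rewrite /unlabelled -cGH; congr Tagged; apply/setP => A.
  case: (bij_f) => g fK gK.
  apply/imsetP/imsetP => -[h]; rewrite inE => /injectiveP inj_h ->.
  + exists [ffun i => f (h i)].
      rewrite inE; apply/injectiveP => i j; rewrite !ffunE.
      by move=> /(can_inj fK) /inj_h.
    by apply/matrixP => i j; rewrite !mxE !ffunE adj_f.
  + exists [ffun i => g (h i)].
      rewrite inE; apply/injectiveP => i j; rewrite !ffunE.
      by move=> /(can_inj gK) /inj_h.
    by apply/matrixP => i j; rewrite !mxE !ffunE -adj_f !gK.
Qed.

Definition card_at (G : sgraph) (v : G) : ugraph :=
  unlabelled (induced [set~ v]).

Definition deck (G : sgraph) : {mset ugraph}%mset :=
  seq_mset [seq card_at v | v <- enum G].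

Definition common_cards (G H : sgraph) : nat :=
  size (deck G `&` deck H)%mset.

Definition reconstructible_from (k : nat) (T : Type) (f : sgraph -> T)
    (G : sgraph) : Prop :=
  forall H : sgraph, (k <= common_cards G H)%N -> f H = f G.

Definition complete (G : sgraph) : bool :=
  [forall x : G, forall y : G, (x != y) ==> adj x y].

Definition clique_count (r : nat) (G : sgraph) : nat :=
  #|[set S : {set G} | (#|S| == r) && complete (induced S)]|.

Definition degree (G : sgraph) (v : G) : nat := #|[set w | adj v w]|.

Definition avg_degree (G : sgraph) : rat :=
  ((\sum_(v : G) degree v)%N%:R / #|G|%:R)%R.

(* Main.v *)
(* Let the cards of v and phi v agree for all vertices v of G but one, u.  By
   Kelly's lemma, if k_r(H) = k_r(G) + a, then phi raises the number of r-cliques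
   through every v != u by a, and u lies in (n-1-r) a more r-cliques than phi u.

   For r = 2 and a > 0, Kelly's double count of the vertices of degree < k over all
   cards shows that at most k vertices of G have degree < k for k up to about n/2,
   so the average degree of G is at least about 3n/8.  Hence G and H have equally
   many edges, and phi preserves degrees.

   For general r and a > 0, suppose that G has no vertex of degree i+1 and
   i <= n-4.  Then for each t the number of vertices with degree i on t r-cliques
   obeys Kelly's count, which forces it to agree in G and H as soon as it is at
   most 1.  By induction on t, degree i does not occur unless i = degree u, and in
   that case the clique degrees in this class form an arithmetic progression of
   length n-r.  Comparing cards then makes the class a clique, which, since every
   v != u has degree >= r-1, is impossible in a sparse graph.  So the set of degrees
   is upwards closed up to n-3; as some degree is at most 3n/8, all degrees between
   n/2 and n-3 occur, and again the average degree is at least about 3n/8. *)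
Require Import Defs.
From mathcomp Require Import all_boot all_order all_algebra.
From mathcomp Require Import finmap multiset zify lra.

Set Implicit Arguments.
Unset Strict Implicit.
Unset Printing Implicit Defensive.

Import Order.TTheory GRing.Theory Num.Theory.

(** * Cliques and cards *)

(** Cliques are kept as subsets of the ambient vertex set, so that those of a card can be pushed
    into the graph along [val]. *)
Definition is_clique (G : sgraph) (S : {set G}) : bool :=
  [forall x in S, forall y in S, (x != y) ==> adj x y].

Definition kcliques (r : nat) (G : sgraph) : {set {set G}} :=
  [set S : {set G} | (#|S| == r) && is_clique S].

Definition clique_degree (r : nat) (G : sgraph) (x : G) : nat :=
  #|[set S in kcliques r G | x \in S]|.

Lemma is_cliqueP (G : sgraph) (S : {set G}) :
  reflect {in S &, forall x y, x != y -> adj x y} (is_clique S).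
Proof.
apply: (iffP forall_inP) => H x.
  by move=> y xS yS; apply/implyP; move/forall_inP: (H x xS); apply.
by move=> xS; apply/forall_inP => y yS; apply/implyP; apply: H.
Qed.

Lemma complete_induced (G : sgraph) (S : {set G}) :
  complete (induced S) = is_clique S.
Proof.
apply/forallP/is_cliqueP => H.
  move=> x y xS yS; apply/implyP.
  by move/forallP/(_ (Sub y yS)): (H (Sub x xS)).
by move=> x; apply/forallP => y; apply/implyP; apply: H; apply: valP.
Qed.

Lemma clique_countE (r : nat) (G : sgraph) :
  clique_count r G = #|kcliques r G|.
Proof. by apply: eq_card => S; rewrite !inE complete_induced. Qed.

(** Induced embeddings preserve and reflect cliques. The two uses are [val] on a card, whose image
    omits the deleted vertex, and isomorphisms. *)
Lemma imset_kcliques (r : nat) (G H : sgraph) (f : G -> H) :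
    injective f -> (forall x y, adj (f x) (f y) = adj x y) ->
  [set f @: S | S : {set G} in kcliques r G] =
  [set T in kcliques r H | T \subset f @: setT].
Proof.
move=> inj_f adj_f; apply/setP => T; rewrite !inE.
have cliqueE (S : {set G}) : is_clique (f @: S) = is_clique S.
  apply/is_cliqueP/is_cliqueP => cS x y.
    move=> xS yS xy; rewrite -adj_f cS ?imset_f //.
    by apply: contra_neq xy => /inj_f.
  case/imsetP=> x' xS ->; case/imsetP=> y' yS -> xy.
  by rewrite adj_f cS //; apply: contra_neq xy => ->.
apply/imsetP/idP => [[S] | /andP[/andP[cT kT] sT]].
  rewrite inE => /andP[cS kS] ->.
  by rewrite card_imset // cS cliqueE kS imsetS ?subsetT.
have defT : T = f @: (f @^-1: T).
  apply/setP => y; apply/idP/imsetP => [yT | [x]]; last by rewrite inE => ? ->.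
  by have /imsetP[x _ def_y] := subsetP sT y yT; exists x; rewrite ?inE -?def_y.
exists (f @^-1: T) => //.
by rewrite inE -cliqueE -(card_imset _ inj_f) -defT cT.
Qed.

Lemma clique_count_embed (r : nat) (G H : sgraph) (f : G -> H) :
    injective f -> (forall x y, adj (f x) (f y) = adj x y) ->
  clique_count r G = #|[set T in kcliques r H | T \subset f @: setT]|.
Proof.
move=> inj_f adj_f; rewrite -imset_kcliques // card_imset ?clique_countE //.
exact: imset_inj.
Qed.

Lemma clique_degree_embed (r : nat) (G H : sgraph) (f : G -> H) (x : G) :
    injective f -> (forall x y, adj (f x) (f y) = adj x y) ->
  clique_degree r x =
  #|[set T in kcliques r H | (f x \in T) && (T \subset f @: setT)]|.
Proof.
move=> inj_f adj_f; rewrite /clique_degree -(card_imset _ (imset_inj inj_f)).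
apply: eq_card => T; rewrite !inE [RHS]andbCA; apply/imsetP/andP => [[S]|].
  rewrite inE => /andP[kS xS] ->; split; first exact: imset_f.
  have : f @: S \in [set f @: S | S : {set G} in kcliques r G] by apply: imset_f.
  by rewrite imset_kcliques // !inE.
case=> fxT kT.
have : T \in [set f @: S | S : {set G} in kcliques r G].
  by rewrite imset_kcliques // !inE.
case/imsetP=> S kS defT; exists S => //.
by rewrite inE kS /=; move: fxT; rewrite defT mem_imset.
Qed.

Lemma imset_val_induced (G : sgraph) (S : {set G}) :
  (val : induced S -> G) @: setT = S.
Proof.
apply/setP => x; apply/imsetP/idP => [[y _ ->] | xS]; first exact: valP.
by exists (Sub x xS).
Qed.

Lemma imsetT_bij (S T : finType) (f : S -> T) : bijective f -> f @: setT = setT.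
Proof.
case=> g fK gK; apply/setP => y; rewrite inE -[y]gK.
by apply: imset_f; rewrite inE.
Qed.

Lemma subset_setC1 (T : finType) (A : {set T}) (v : T) :
  (A \subset [set~ v]) = (v \notin A).
Proof. by rewrite -setCS setCK sub1set inE. Qed.

(** Cliques avoiding [v] are exactly those of the card; the others are counted by the clique degree.
    This is the local form of Kelly's lemma. *)
Lemma clique_count_card (r : nat) (G : sgraph) (v : G) :
  clique_count r G = clique_count r (induced [set~ v]) + clique_degree r v.
Proof.
rewrite (@clique_count_embed r (induced [set~ v]) G val) //; last exact: val_inj.
rewrite imset_val_induced clique_countE.
rewrite -(cardsID [set S : {set G} | v \in S] (kcliques r G)) addnC /clique_degree.
congr (_ + _); apply: eq_card => S; rewrite !inE ?subset_setC1 //.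
by rewrite andbC.
Qed.

Lemma sum_card_rel (S T : finType) (A : pred S) (R : S -> T -> bool) :
  \sum_(v : T) #|[set x in A | R x v]| = \sum_(x in A) #|[set v | R x v]|.
Proof.
transitivity (\sum_v \sum_(x in A) R x v : nat).
  by apply: eq_bigr => v _; rewrite -big_mkcondr sum1dep_card.
by rewrite exchange_big; apply: eq_bigr => x _; rewrite -big_mkcond sum1dep_card.
Qed.

Lemma sum_clique_degree (r : nat) (G : sgraph) :
  \sum_(v : G) clique_degree r v = r * clique_count r G.
Proof.
rewrite clique_countE [LHS](@sum_card_rel _ _ (mem (kcliques r G)) (fun S v => v \in S)).
rewrite mulnC -sum_nat_const; apply: eq_bigr => S; rewrite inE => /andP[/eqP <- _].
by apply: eq_card => v; rewrite inE.
Qed.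

Lemma clique_degree2 (G : sgraph) (v : G) : clique_degree 2 v = degree v.
Proof.
rewrite /degree -(@card_in_imset _ _ (fun w => [set v; w])); last first.
  move=> w1 w2; rewrite !inE => a1 a2 /setP/(_ w1).
  rewrite !inE eqxx orbT => /esym/orP[]/eqP // e.
  by rewrite e adj_irrefl in a1.
apply: eq_card => S; rewrite !inE; apply/andP/imsetP => [[/andP[cS kS] vS]|[w]].
  have /cards1P[w defw] : #|S :\ v| == 1.
    by move: cS; rewrite (cardsD1 v) vS.
  have : w \in S :\ v by rewrite defw inE.
  rewrite !inE => /andP[wv wS]; exists w.
    by rewrite inE (is_cliqueP _ kS) // eq_sym.
  by rewrite -(setD1K vS) defw.
rewrite inE => avw ->; have vw : v != w.
  by apply/eqP => e; move: avw; rewrite e adj_irrefl.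
rewrite cards2 vw !inE eqxx; split=> //=; apply/is_cliqueP => x y.
by rewrite !inE => /orP[]/eqP -> /orP[]/eqP ->; rewrite ?eqxx // adj_sym.
Qed.

Lemma sum_degree (G : sgraph) : \sum_(v : G) degree v = 2 * clique_count 2 G.
Proof. by rewrite -sum_clique_degree; apply: eq_bigr => v _; rewrite clique_degree2. Qed.

Lemma leq_degree_clique (r : nat) (G : sgraph) (v : G) :
  0 < clique_degree r v -> r <= (degree v).+1.
Proof.
case/card_gt0P=> S; rewrite !inE => /andP[/andP[/eqP <- kS] vS].
rewrite (cardsD1 v) vS add1n ltnS; apply/subset_leq_card/subsetP => w.
by rewrite !inE => /andP[wv wS]; rewrite (is_cliqueP _ kS) // eq_sym.
Qed.

Lemma degree_card (G : sgraph) (v : G) (x : induced [set~ v]) :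
  degree (val x) = degree x + adj v (val x).
Proof.
rewrite /degree -(card_imset _ (@val_inj _ _ (induced [set~ v]))).
rewrite (cardsD1 v) inE adj_sym addnC; congr (_ + _).
apply: eq_card => y; rewrite !inE; apply/andP/imsetP => [[yv axy]|[z]].
  have yP : y \in [set~ v] by rewrite !inE.
  by exists (Sub y yP); rewrite ?inE.
by rewrite inE => axz ->; split=> //; have := valP z; rewrite !inE.
Qed.

(** A clique containing both [x] and [v] would make them adjacent, so deleting [v] destroys no
    clique through [x]. *)
Lemma clique_degree_card (r : nat) (G : sgraph) (v : G) (x : induced [set~ v]) :
  ~~ adj v (val x) -> clique_degree r (val x) = clique_degree r x.
Proof.
move=> nvx; rewrite (@clique_degree_embed r (induced [set~ v]) G val x) //;
  last exact: val_inj.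
rewrite imset_val_induced; apply: eq_card => S; rewrite !inE subset_setC1.
rewrite -[LHS]andbA -[RHS]andbA; congr (_ && _); apply/andP/and3P => [[kS xS]|[]//]; split=> //.
apply: contra nvx => vS; apply: (is_cliqueP _ kS) => //.
by have := valP x; rewrite !inE eq_sym.
Qed.

Lemma isomorphic_sym (G H : sgraph) : isomorphic G H -> isomorphic H G.
Proof.
case=> f [g fK gK] adj_f; exists g; first by exists f.
by move=> x y; rewrite -adj_f !gK.
Qed.

Lemma isomorphic_clique_count (r : nat) (G H : sgraph) :
  isomorphic G H -> clique_count r G = clique_count r H.
Proof.
case=> f bij_f adj_f; rewrite (clique_count_embed r (bij_inj bij_f) adj_f).
rewrite clique_countE; apply: eq_card => S.
by rewrite inE imsetT_bij // subsetT andbT.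
Qed.

Lemma isomorphic_clique_degree (r : nat) (G H : sgraph) (f : G -> H) (x : G) :
    bijective f -> (forall x y, adj (f x) (f y) = adj x y) ->
  clique_degree r (f x) = clique_degree r x.
Proof.
move=> bij_f adj_f; rewrite (clique_degree_embed r x (bij_inj bij_f) adj_f).
by apply: eq_card => S; rewrite !inE imsetT_bij // subsetT andbT.
Qed.

(** The predicate [P] is arbitrary so that one statement serves both [low] and [profile]. *)
Lemma isomorphic_profile (r : nat) (P : nat -> nat -> bool) (G H : sgraph) :
    isomorphic G H ->
  #|[set x : G | P (degree x) (clique_degree r x)]| =
  #|[set y : H | P (degree y) (clique_degree r y)]|.
Proof.
case=> f bij_f adj_f; have inj_f := bij_inj bij_f.
rewrite -(card_imset _ inj_f); apply: eq_card => y; rewrite inE.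
have [g fK gK] := bij_f; rewrite -(gK y) mem_imset // inE.
by rewrite -!clique_degree2 !(isomorphic_clique_degree _ _ bij_f adj_f).
Qed.

(** * Matching the common cards *)

(** The cards of [u] and [phi u] are left unconstrained: this is the pair about which n-1 common
    cards say nothing. *)
Definition matching (G H : sgraph) (phi : G -> H) (u : G) : Prop :=
  bijective phi /\
  forall v, v != u -> isomorphic (induced [set~ v]) (induced [set~ phi v]).

Lemma perm_map_preimage (T U : eqType) (f : T -> U) (s : seq T) (t : seq U) :
  perm_eq (map f s) t -> exists2 s', perm_eq s s' & t = map f s'.
Proof.
case: s => [|x0 s]; first by rewrite perm_sym => /perm_nilP ->; exists [::].
rewrite perm_sym => /(perm_iotaP (f x0))[Is pIs ->].
exists (map (nth x0 (x0 :: s)) Is); last first.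
  rewrite -map_comp; apply/eq_in_map => i; rewrite (perm_mem pIs) mem_iota size_map /=.
  by move=> lt_i; rewrite -(nth_map _ (f x0)).
rewrite perm_sym; apply/(perm_iotaP x0); exists Is => //.
by move: pIs; rewrite size_map.
Qed.

Lemma perm_msetI (K : choiceType) (A B : {mset K}%mset) :
  perm_eq ((A `&` B)%mset ++ (A `\` B)%mset) A.
Proof.
apply/allP => x _ /=; rewrite count_cat !count_mem_mset !msetE2; lia.
Qed.

(** Both families are listed with the intersection of the two label multisets in front, so common
    labels occupy equal positions. *)
Lemma exists_enum_matching (T : choiceType) (X Y : finType) (f : X -> T)
    (g : Y -> T) (k : nat) :
    k <= size (seq_mset (map f (enum X)) `&` seq_mset (map g (enum Y)))%mset ->
  exists (xs : seq X) (ys : seq Y),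
    [/\ perm_eq (enum X) xs, perm_eq (enum Y) ys &
        take k (map f xs) = take k (map g ys)].
Proof.
set A := seq_mset _; set B := seq_mset _ => le_k.
have pA : perm_eq (map f (enum X)) ((A `&` B)%mset ++ (A `\` B)%mset).
  by rewrite perm_sym (perm_trans (perm_msetI _ _)) ?perm_eq_seq_mset.
have pB : perm_eq (map g (enum Y)) ((A `&` B)%mset ++ (B `\` A)%mset).
  by rewrite msetIC perm_sym (perm_trans (perm_msetI _ _)) ?perm_eq_seq_mset.
have [xs pxs fxs] := perm_map_preimage pA.
have [ys pys gys] := perm_map_preimage pB.
by exists xs, ys; split; rewrite // -fxs -gys !takel_cat.
Qed.

(** The tag of a card is its order, one less than that of the graph. A single common card thus fixes
    the order of [H]. *)
Lemma card_at_size (G H : sgraph) (v : G) (w : H) :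
  card_at v = card_at w -> #|G| = #|H|.
Proof.
move/(congr1 tag) => /=; rewrite !card_sig.
have E (K : sgraph) (x : K) : #|[pred y | y \in [set~ x]]| = #|K|.-1.
  by rewrite -(cardsC1 x); apply: eq_card => y; rewrite !inE.
rewrite !E; have : 0 < #|G| by apply/card_gt0P; exists v.
have : 0 < #|H| by apply/card_gt0P; exists w.
by case: #|G| #|H| => [|a] [|b] //= _ _ ->.
Qed.

Lemma common_cards_matching (G H : sgraph) :
    1 < #|G| -> #|G| - 1 <= common_cards G H ->
  exists (phi : G -> H) (u : G), matching phi u.
Proof.
move=> G_gt1 /exists_enum_matching[xs [ys [pxs pys eq_cards]]].
have size_xs : size xs = #|G| by rewrite -(perm_size pxs) cardE.
have size_ys : size ys = #|H| by rewrite -(perm_size pys) cardE.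
have [x0 _] : exists x0 : G, true by have /card_gt0P[x _] := ltnW G_gt1; exists x.
have H_gt0 : 0 < #|H|.
  have := congr1 size eq_cards.
  by rewrite !size_take_min !size_map size_xs size_ys; lia.
have [y0 _] : exists y0 : H, true by have /card_gt0P[y _] := H_gt0; exists y.
have eq_nth i : i < #|G| - 1 -> card_at (nth x0 xs i) = card_at (nth y0 ys i).
  move=> lt_i; have lt_j : i < size ys.
    have := congr1 size eq_cards.
    by rewrite !size_take_min !size_map size_xs; lia.
  have := congr1 (nth (card_at x0) ^~ i) eq_cards.
  by rewrite !nth_take // (nth_map x0) ?(nth_map y0) //; lia.
have cGH : #|G| = #|H| by apply: (card_at_size (eq_nth 0 _)); lia.
have ux : uniq xs by rewrite -(perm_uniq pxs) enum_uniq.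
have uy : uniq ys by rewrite -(perm_uniq pys) enum_uniq.
have xsP x : x \in xs by rewrite -(perm_mem pxs) mem_enum.
(* Vertices are matched by position; [u] is the last entry, the only position not covered by
   [eq_nth]. *)
exists (fun x => nth y0 ys (index x xs)), (nth x0 xs (#|G| - 1)); split.
  apply: inj_card_bij; last by rewrite cGH.
  move=> x x' /eqP; rewrite nth_uniq ?size_ys -?cGH -?size_xs ?index_mem //.
  by move/eqP/index_inj; apply.
move=> v vu; apply/unlabelledP.
rewrite -[v in unlabelled (induced [set~ v])](nth_index x0 (xsP v)).
apply: eq_nth; have : index v xs != #|G| - 1.
  by apply: contra_neq vu => <-; rewrite nth_index.
have : index v xs < #|G| by rewrite -size_xs index_mem.
lia.
Qed.

Lemma matching_sym (G H : sgraph) (phi : G -> H) (u : G) :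
  matching phi u -> exists psi : H -> G, matching psi (phi u).
Proof.
case=> -[psi phiK psiK] iso_phi; exists psi; split; first by exists phi.
move=> w wu; apply: isomorphic_sym; rewrite -[w in isomorphic _ (induced [set~ w])]psiK.
by apply: iso_phi; apply: contra_neq wu => <-.
Qed.

Lemma matching_card (G H : sgraph) (phi : G -> H) (u : G) :
  matching phi u -> #|G| = #|H|.
Proof. by case=> /bij_eq_card. Qed.

Lemma matching_sum (G H : sgraph) (phi : G -> H) (u : G) (F : G -> nat) (F' : H -> nat) :
    matching phi u -> (forall v, v != u -> F v = F' (phi v)) ->
  (\sum_v F v) + F' (phi u) = (\sum_w F' w) + F u.
Proof.
case=> bij_phi _ eqF.
rewrite [X in _ = X + _](reindex phi) /=; last exact: onW_bij.
rewrite (bigD1 u) // [in RHS](bigD1 u) //= (eq_bigr (F' \o phi)) //=; lia.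
Qed.

Lemma matching_clique_degree (r : nat) (G H : sgraph) (phi : G -> H) (u v : G) :
    matching phi u -> v != u ->
  clique_count r H + clique_degree r v = clique_count r G + clique_degree r (phi v).
Proof.
case=> _ iso_phi /iso_phi/(isomorphic_clique_count r).
rewrite (clique_count_card r v) (clique_count_card r (phi v)); lia.
Qed.

(** Sum [matching_clique_degree] over all v != u and use [sum_clique_degree]. The additive form
    avoids truncated subtraction. *)
Lemma matching_clique_degree_exception (r : nat) (G H : sgraph) (phi : G -> H) (u : G) :
    matching phi u ->
  (#|G| - 1) * clique_count r H + r * clique_count r G + clique_degree r (phi u) =
  (#|G| - 1) * clique_count r G + r * clique_count r H + clique_degree r u.
Proof.
move=> m.
have := @matching_sum _ _ _ _ (fun v => clique_count r H + clique_degree r v)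
  (fun w => clique_count r G + clique_degree r w) m
  (fun v => @matching_clique_degree r _ _ _ u v m).
rewrite !big_split /= !sum_nat_const !sum_clique_degree -(matching_card m).
have : 0 < #|G| by apply/card_gt0P; exists u.
case: #|G| => // n _; rewrite subn1 /= !mulSn; lia.
Qed.

(** * Vertices of small degree *)

Definition low (G : sgraph) (k : nat) : nat := #|[set x : G | degree x < k]|.

Definition card_low (G : sgraph) (k : nat) (v : G) : nat := low (induced [set~ v]) k.

Lemma card_induced_set (G : sgraph) (S : {set G}) (Q : pred (induced S)) (P : pred G) :
    (forall x, Q x = P (val x)) ->
  #|[set x | Q x]| = #|[set x in S | P x]|.
Proof.
move=> QP; rewrite -(card_imset _ (@val_inj _ _ (induced S))).
apply: eq_card => y; rewrite !inE; apply/imsetP/andP => [[x]|[yS Py]].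
  by rewrite inE QP => Px ->; split=> //; apply: valP.
by exists (Sub y yS); rewrite ?inE ?QP.
Qed.

Lemma card_lowE (G : sgraph) (k : nat) (v : G) :
  card_low k v = #|[set x | (x != v) && (degree x < k + adj v x)]|.
Proof.
rewrite /card_low /low (card_induced_set (P := fun x => degree x < k + adj v x)).
  by apply: eq_card => x; rewrite !inE.
by move=> x; rewrite degree_card ltn_add2r.
Qed.

Lemma lowS (G : sgraph) (k : nat) :
  low G k.+1 = low G k + #|[set x : G | degree x == k]|.
Proof.
rewrite /low -(cardsID [set x | degree x < k]); congr (_ + _);
  by apply: eq_card => x; rewrite !inE; lia.
Qed.

(** A vertex of degree below k is low in all n-1 cards that contain it; a vertex of degree k is low
    exactly in the k cards of its neighbours. *)
Lemma sum_card_low (G : sgraph) (k : nat) :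
  \sum_(v : G) card_low k v + k * low G k = (#|G| - 1) * low G k + k * low G k.+1.
Proof.
rewrite lowS mulnDr addnCA addnC; congr (_ + _).
under eq_bigr do rewrite card_lowE.
rewrite [LHS](@sum_card_rel _ _ xpredT (fun x v => (x != v) && (degree x < k + adj v x))).
transitivity (\sum_(x : G) ((if degree x < k then #|G| - 1 else 0) +
                            (if degree x == k then k else 0))).
  apply: eq_bigr => x _; case: ltngtP => [lt|gt|eq_k].
  - rewrite addn0 subn1 -(cardsC1 x); apply: eq_card => v; rewrite !inE eq_sym.
    by rewrite (leq_trans lt) ?leq_addr ?andbT.
  - apply/eqP; rewrite cards_eq0; apply/eqP/setP => v; rewrite !inE.
    by apply/negbTE/nandP; right; rewrite -leqNgt; case: (adj v x); lia.
  - rewrite add0n -[RHS]eq_k; apply: eq_card => v; rewrite !inE eq_k adj_sym.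
    have [->|_] := eqVneq x v; first by rewrite adj_irrefl.
    by case: (adj x v); lia.
rewrite big_split /= -!big_mkcond !sum_nat_const /low.
by rewrite !cardsE [k * _]mulnC [(_ - _) * _]mulnC.
Qed.

Lemma low_monotone (G : sgraph) (k l : nat) : k <= l -> low G k <= low G l.
Proof.
by move=> kl; apply/subset_leq_card/subsetP => x; rewrite !inE => /leq_trans; apply.
Qed.

Lemma card_low_le (G : sgraph) (k : nat) (v : G) : card_low k v <= low G k.+1.
Proof.
rewrite card_lowE; apply/subset_leq_card/subsetP => x; rewrite !inE.
by case: (adj v x); lia.
Qed.

Lemma low_card_le (G : sgraph) (k : nat) (v : G) : low G k <= (card_low k v).+1.
Proof.
rewrite card_lowE /low (cardsD1 v) -add1n leq_add ?leq_b1 //.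
apply/subset_leq_card/subsetP => x; rewrite !inE => /andP[-> lt] /=; lia.
Qed.

Lemma matching_card_low (G H : sgraph) (phi : G -> H) (u v : G) (k : nat) :
  matching phi u -> v != u -> card_low k v = card_low k (phi v).
Proof. by case=> _ iso_phi /iso_phi/(isomorphic_profile 0 (fun d _ => d < k)). Qed.

(** The inverse of [phi] lowers degrees except at [phi u], which accounts for the extra 1. *)
Lemma leq_low_matching (G H : sgraph) (phi : G -> H) (u : G) (k : nat) :
    matching phi u -> (forall v, v != u -> degree v < degree (phi v)) ->
  low H k.+1 <= (low G k).+1.
Proof.
move=> m lt_deg; have [psi phiK psiK] := m.1.
rewrite /low (cardsD1 (phi u)) -[leqRHS]add1n leq_add ?leq_b1 //.
rewrite -[leqRHS](card_imset _ (can_inj phiK)).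
apply/subset_leq_card/subsetP => y; rewrite !inE -[y]psiK => /andP[yu lt_y].
rewrite mem_imset ?inE; last exact: can_inj phiK.
have /lt_deg : psi y != u by apply: contra_neq yu => ->.
lia.
Qed.

(* The cards of u and phi u, which need not agree, are only estimated, by
   card_low_le and low_card_le. *)
Lemma low_step (G H : sgraph) (phi : G -> H) (u : G) (k : nat) :
    matching phi u -> (forall v, v != u -> degree v < degree (phi v)) ->
    k + 3 <= #|G| ->
  (#|G| - 3 - k) * low G k.+1 <= (#|G| - 3 - k) * low G k + (#|G| - 1).
Proof.
move=> m lt_deg le_k.
have := matching_sum m (fun v => @matching_card_low _ _ _ _ v k.+1 m).
have := sum_card_low G k.+1; have := sum_card_low H k.+1.
rewrite -(matching_card m).
have := card_low_le k.+1 u; have := low_card_le k.+1 (phi u).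
have := leq_low_matching k m lt_deg; have := leq_low_matching k.+1 m lt_deg.
have := low_monotone G (leqnSn k.+1).
have [j ->] : exists j, #|G| = k + 3 + j by exists (#|G| - (k + 3)); lia.
have -> : k + 3 + j - 3 - k = j by lia.
have -> : k + 3 + j - 1 = k + 2 + j by lia.
move: (low G k) (low G k.+1) (low G k.+2) (low H k.+1) (low H k.+2) => a b c a' b'.
move=> h1 h2 h3.
have := leq_mul (leqnn k) h1; have := leq_mul (leqnn k.+1) h2.
have := leq_mul (leqnn j) h3.
lia.
Qed.

(** In this range n-1 < 2(n-3-k) at each step of the induction, so [low_step] lets [low] grow by at
    most 1 at a time. *)
Lemma low_le (G H : sgraph) (phi : G -> H) (u : G) (k : nat) :
    matching phi u -> (forall v, v != u -> degree v < degree (phi v)) ->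
  2 * k + 3 < #|G| -> low G k <= k.
Proof.
move=> m lt_deg; elim: k => [|k IHk] lt_k.
  by rewrite leqn0 cards_eq0; apply/eqP/setP => x; rewrite !inE.
have le_k : low G k <= k by apply: IHk; lia.
have := low_step m lt_deg (k := k).
by move: le_k lt_k; move: (low G k) (low G k.+1) #|G| => a b n; nia.
Qed.

(** The sum of degrees is at least the sum over j < K of the number of vertices of degree above j,
    and at most j+1 vertices fail this. *)
Lemma leq_sum_degree_low (G : sgraph) (K : nat) :
    (forall j, j <= K -> low G j <= j) ->
  \sum_(j < K) (#|G| - j.+1) <= \sum_(v : G) degree v.
Proof.
move=> le_low.
have leq_d d : \sum_(j < K) (j < d) <= d.
  elim: K {le_low} => [|K IHK]; first by rewrite big_ord0.
  suff -> : \sum_(j < K.+1) (j < d) = minn K.+1 d by exact: geq_minr.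
  by elim: K.+1 => [|k IHk]; rewrite ?big_ord0 ?min0n // big_ord_recr /= IHk; lia.
apply: (@leq_trans (\sum_(v : G) \sum_(j < K) (j < degree v))); last exact: leq_sum.
rewrite exchange_big; apply: leq_sum => j _; rewrite leq_subLR.
apply: leq_trans (leq_add (le_low j.+1 (ltn_ord j)) (leqnn _)).
rewrite (_ : \sum_v _ = #|~: [set x : G | degree x < j.+1]|) ?cardsC //.
by rewrite -sum1_card [RHS]big_mkcond; apply: eq_bigr => v _; rewrite !inE -leqNgt; case: ltnP.
Qed.

(** * Degree classes below a gap *)

Definition profile (r i t : nat) (G : sgraph) : nat :=
  #|[set x : G | (degree x == i) && (clique_degree r x == t)]|.

Lemma profile_gt0 (r i t : nat) (G : sgraph) (x : G) :
  degree x = i -> clique_degree r x = t -> 0 < profile r i t G.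
Proof. by move=> dx kx; apply/card_gt0P; exists x; rewrite inE dx kx !eqxx. Qed.

(** By the gap, no vertex falls from degree i+1 to i when [v] is deleted. Members of the class
    adjacent to [v] leave it; the others keep their degree and their cliques. *)
Lemma profile_cardE (r i t : nat) (G : sgraph) (v : G) :
    (forall x : G, degree x != i.+1) ->
  profile r i t (induced [set~ v]) =
  #|[set x in [set x : G | (degree x == i) && (clique_degree r x == t)]
    | (x != v) && ~~ adj v x]|.
Proof.
move=> gap; rewrite /profile (card_induced_set
  (P := fun x => [&& degree x == i, clique_degree r x == t & ~~ adj v x])).
  by apply: eq_card => x; rewrite !inE; do !case: (_ == _); rewrite ?andbF.
move=> x; have := degree_card x; have := gap (val x).
case: (boolP (adj v (val x))) => [_ | nvx].
  by rewrite !andbF addn1 => /[swap] ->; rewrite eqSS => /negbTE->.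
by rewrite addn0 clique_degree_card // andbT => _ ->.
Qed.

Lemma sum_profile_card (r i t : nat) (G : sgraph) :
    (forall x : G, degree x != i.+1) ->
  \sum_(v : G) profile r i t (induced [set~ v]) = profile r i t G * (#|G| - 1 - i).
Proof.
move=> gap; under eq_bigr do rewrite profile_cardE //.
rewrite [LHS](@sum_card_rel _ _ (mem [set x | _]) (fun x v => (x != v) && ~~ adj v x)).
rewrite -sum_nat_const; apply: eq_bigr => x; rewrite inE => /andP[/eqP <- _].
have /= := cardsC (x |: [set w | adj x w]).
rewrite cardsU1 inE adj_irrefl /= -/(degree x) => <-.
rewrite [RHS](_ : _ = #|~: (x |: [set w | adj x w])|); last by lia.
by apply: eq_card => v; rewrite !inE negb_or eq_sym adj_sym.
Qed.

Lemma matching_profile_card (r i t : nat) (G H : sgraph) (phi : G -> H) (u v : G) :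
    matching phi u -> v != u ->
  profile r i t (induced [set~ v]) = profile r i t (induced [set~ phi v]).
Proof.
by case=> _ iso_phi /iso_phi/(isomorphic_profile r (fun d c => (d == i) && (c == t))).
Qed.

Lemma profile_card_le (r i t : nat) (G : sgraph) (v : G) :
    (forall x : G, degree x != i.+1) ->
  profile r i t (induced [set~ v]) <= profile r i t G.
Proof.
move=> gap; rewrite profile_cardE //; apply/subset_leq_card/subsetP => x.
by rewrite inE => /andP[].
Qed.

(** With p, q the profiles of G, H and D = n-1-i, the double counts give p D + q' = q D + p' for
    some p' <= p, q' <= q. As D >= 3, q <= 1 forces p = q. *)
Lemma profile_matching (r i t : nat) (G H : sgraph) (phi : G -> H) (u : G) :
    matching phi u ->
    (forall x : G, degree x != i.+1) -> (forall y : H, degree y != i.+1) ->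
    i + 4 <= #|G| -> profile r i t H <= 1 ->
  profile r i t G = profile r i t H.
Proof.
move=> m gapG gapH le_i.
have := @matching_sum _ _ _ _ _ (fun w => profile r i t (induced [set~ w])) m
  (fun v => @matching_profile_card r i t _ _ _ _ v m).
rewrite !sum_profile_card // -(matching_card m).
have := profile_card_le r t u gapG; have := profile_card_le r t (phi u) gapH.
have [D ->] : exists D, #|G| - 1 - i = D + 3 by exists (#|G| - 4 - i); lia.
move: (profile r i t G) (profile r i t H) => p q.
move=> le_q le_p eq_pq; case: q le_q eq_pq => [|[|//]] le_q eq_pq _.
  nia.
case: p le_p eq_pq => [|[|p]] le_p eq_pq //; nia.
Qed.

Lemma profile_reindex (r i t : nat) (G H : sgraph) (phi : G -> H) :
    bijective phi -> (forall v, degree (phi v) = degree v) ->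
  profile r i t H = #|[set v : G | (degree v == i) && (clique_degree r (phi v) == t)]|.
Proof.
move=> [psi phiK psiK] deg; rewrite -(card_imset _ (can_inj phiK)).
by apply: eq_card => y; rewrite -[y]psiK mem_imset ?inE ?deg //; apply: can_inj phiK.
Qed.

(* A vertex of degree i with fewest r-cliques would have no counterpart in H. *)
Lemma no_gap_above (r i a : nat) (G H : sgraph) (phi : G -> H) (u : G) :
    matching phi u -> (forall v, degree (phi v) = degree v) -> 0 < a ->
    (forall v, v != u -> clique_degree r (phi v) = clique_degree r v + a) ->
    (forall x : G, degree x != i.+1) -> i + 4 <= #|G| -> i != degree u ->
  forall x : G, degree x != i.
Proof.
move=> m deg a_gt0 shift gap le_i iu.
have gapH (y : H) : degree y != i.+1.
  by have [[psi _ psiK] _] := m; rewrite -[y]psiK deg.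
suff p0 t : profile r i t G = 0.
  move=> x; apply/eqP => dx.
  by have := profile_gt0 dx (erefl (clique_degree r x)); rewrite p0.
elim/ltn_ind: t => t IH; suff pH : profile r i t H = 0.
  by rewrite (profile_matching m gap gapH) ?pH.
rewrite (profile_reindex _ _ _ m.1 deg); apply/eqP; rewrite cards_eq0.
apply/eqP/setP => v; rewrite !inE; apply/negbTE/andP => -[/eqP dv].
(* A vertex of H on t cliques comes from one of G on t-a cliques, excluded by induction; [u] is not
   in this degree class. *)
rewrite shift; last by apply: contra_neq iu => <-; rewrite dv.
move/eqP=> kv; have lt_t : clique_degree r v < t by lia.
by have := profile_gt0 dv (erefl (clique_degree r v)); rewrite (IH _ lt_t).
Qed.

(** In the class of [u], H has the clique degrees of G shifted by a, except that the largest one,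
    that of [u], is replaced by that of [phi u]. Inductively the values form a progression from
    [phi u] to [u], each taken once. *)
Lemma profile_exceptional (r a M : nat) (G H : sgraph) (phi : G -> H) (u : G) :
    matching phi u -> (forall v, degree (phi v) = degree v) -> 0 < a ->
    (forall v, v != u -> clique_degree r (phi v) = clique_degree r v + a) ->
    clique_degree r u = clique_degree r (phi u) + M * a ->
    (forall x : G, degree x != (degree u).+1) -> degree u + 4 <= #|G| ->
  forall t, profile r (degree u) t G = profile r (degree u) t H /\
    profile r (degree u) t G =
      [exists j : 'I_M.+1, t == clique_degree r (phi u) + j * a].
Proof.
move=> m deg a_gt0 shift top gap le_u.
set s := degree u; set t0 := clique_degree r (phi u).
have gapH (y : H) : degree y != s.+1.
  by have [[psi _ psiK] _] := m; rewrite -[y]psiK deg.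
elim/ltn_ind=> t IH.
suff pH : profile r s t H = [exists j : 'I_M.+1, t == t0 + j * a].
  by rewrite (profile_matching m gap gapH) // pH //; case: [exists _, _].
(* The first term counts [phi u]; the second counts the shifted vertices, with [u] removed. The
   factor [a <= t] guards the truncated t-a. *)
have pHE : profile r s t H =
    (t == t0) + ((a <= t) * (profile r s (t - a) G - (t - a == t0 + M * a))).
  rewrite (profile_reindex _ _ _ m.1 deg) (cardsD1 u) !inE eqxx /= -/t0 eq_sym.
  congr (_ + _); case: leqP => [le_a | lt_a]; last first.
    rewrite mul0n; apply/eqP; rewrite cards_eq0; apply/eqP/setP => v.
    rewrite !inE; apply/negbTE/and3P => -[vu _]; rewrite shift //; lia.
  rewrite mul1n /profile [in RHS](cardsD1 u) !inE eqxx /= top -/t0.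
  rewrite [_ - a == _]eq_sym addKn; apply: eq_card => v; rewrite !inE.
  by have [//|vu] := eqVneq v u; rewrite /= shift //; congr (_ && _); lia.
rewrite pHE; case: leqP => [le_a | lt_a].
  have lt_t : t - a < t by lia.
  rewrite mul1n (IH _ lt_t).2; have [tt0 | nt0] := eqVneq t t0.
    rewrite tt0 in le_a *.
    have -> : [exists j : 'I_M.+1, t0 == t0 + j * a].
      by apply/existsP; exists ord0; rewrite mul0n addn0.
    case: existsP => [[j /eqP tj] | _]; last by rewrite sub0n.
    by move: tj; have := leq0n (j * a); lia.
  rewrite add0n; case: existsP => [[j /eqP tj] | nj].
    (* At j = M the only vertex with t-a cliques is [u], which is not shifted, so the progression
       ends here. *)
    have [jM | jM] := eqVneq (j : nat) M.
      rewrite tj jM eqxx subnn; case: existsP => // -[k /eqP tk].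
      have : k * a = M.+1 * a by lia.
      by move/eqP; rewrite eqn_pmul2r // => /eqP kM; have := ltn_ord k; lia.
    rewrite tj eqn_add2l eqn_pmul2r // (negbTE jM) subn0.
    have lt_j : j.+1 < M.+1 by have := ltn_ord j; lia.
    case: existsP => // -[]; exists (Ordinal lt_j) => /=.
    by apply/eqP; lia.
  rewrite sub0n; case: existsP => // -[[[|j] lt_j] /= /eqP tj].
    by case/eqP: nt0; lia.
  by case: nj; exists (Ordinal (ltnW lt_j)) => /=; apply/eqP; lia.
rewrite mul0n addn0; case: eqVneq => [-> | nt0].
  by case: existsP => // -[]; exists ord0; rewrite mul0n addn0.
case: existsP => // -[[[|j] lt_j] /= /eqP tj]; first by case/eqP: nt0; lia.
lia.
Qed.

(* Equality of the cards of x and phi x turns adjacency of class members of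
   G at clique-degree distance d + 1 into adjacency in H at distance d, and
   conversely. *)
Lemma exceptional_class_clique (r a M : nat) (G H : sgraph) (phi : G -> H) (u : G) :
    matching phi u -> (forall v, degree (phi v) = degree v) -> 0 < a ->
    (forall v, v != u -> clique_degree r (phi v) = clique_degree r v + a) ->
    clique_degree r u = clique_degree r (phi u) + M * a ->
    (forall x : G, degree x != (degree u).+1) -> degree u + 4 <= #|G| ->
  forall d,
    (forall x y : G, degree x = degree u -> degree y = degree u ->
       clique_degree r y = clique_degree r x + d * a -> x = y \/ adj x y) /\
    (forall x y : H, degree x = degree u -> degree y = degree u ->
       clique_degree r y = clique_degree r x + d * a -> x = y \/ adj x y).
Proof.
move=> m deg a_gt0 shift top gap le_u.
have prof := profile_exceptional m deg a_gt0 shift top gap le_u.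
set s := degree u in gap le_u prof *.
have gapH (y : H) : degree y != s.+1.
  by have [[psi _ psiK] _] := m; rewrite -[y]psiK deg.
have profG t : profile r s t G <= 1 by rewrite (prof t).2 leq_b1.
have profH t : profile r s t H <= 1 by rewrite -(prof t).1.
have uniqP (K : sgraph) (x y : K) : (forall t, profile r s t K <= 1) ->
    degree x = s -> degree y = s -> clique_degree r x = clique_degree r y -> x = y.
  move=> le1 dx dy kxy; apply: (card_le1_eqP (le1 (clique_degree r y)));
  by rewrite inE ?dx ?dy ?kxy !eqxx.
have boundG (x : G) : degree x = s -> clique_degree r x <= clique_degree r u.
  move=> dx; have := profile_gt0 dx (erefl (clique_degree r x)).
  rewrite (prof _).2; case: existsP => // -[j /eqP-> _].
  by rewrite top leq_add2l leq_mul2r -ltnS ltn_ord orbT.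
have boundH (y : H) : degree y = s -> clique_degree r (phi u) <= clique_degree r y.
  move=> dy; have := profile_gt0 dy (erefl (clique_degree r y)).
  by rewrite -(prof _).1 (prof _).2; case: existsP => // -[j /eqP-> _]; apply: leq_addr.
(* A class member disappears from the class in the card of [v] only by being [v] or a neighbour;
   this and its converse [cardP] translate equal cards into adjacency. *)
have card0 (K : sgraph) (v x : K) : (forall y : K, degree y != s.+1) -> degree x = s ->
    profile r s (clique_degree r x) (induced [set~ v]) = 0 -> v = x \/ adj v x.
  move=> gapK dx; rewrite profile_cardE // => /eqP; rewrite cards_eq0 => /eqP/setP/(_ x).
  rewrite !inE dx !eqxx /= eq_sym; have [->|_] := eqVneq v x; first by left.
  by move/negbFE; right.
have cardP (K : sgraph) (v : K) t : (forall y : K, degree y != s.+1) ->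
    (forall x : K, degree x = s -> clique_degree r x = t -> x = v \/ adj x v) ->
    profile r s t (induced [set~ v]) = 0.
  move=> gapK adjK; rewrite profile_cardE //; apply/eqP; rewrite cards_eq0.
  apply/eqP/setP => x; rewrite !inE; apply/negbTE/negP.
  case/andP=> /andP[/eqP dx /eqP kx] /andP[xv]; rewrite adj_sym.
  by case: (adjK x dx kx) => [xv'|->] //; rewrite xv' eqxx in xv.
elim=> [|d [IHG IHH]].
  by split=> x y dx dy; rewrite mul0n addn0 => kxy; left; apply: uniqP.
split=> x y dx dy kxy.
  (* [u] has the largest clique degree in its class, and [y] lies strictly above [x]. *)
  have xu : x != u by apply/eqP => e; have := boundG y dy; rewrite kxy e mulSn; lia.
  apply: card0 => //; rewrite (matching_profile_card _ _ _ m xu).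
  apply: cardP => // z dz kz.
  have dpx : degree (phi x) = s by rewrite deg.
  have [|->|] := IHH (phi x) z dpx dz; [|by left|by rewrite adj_sym; right].
  by rewrite kz kxy shift // mulSn; lia.
have [[psi phiK psiK] _] := m.
have yw : y != phi u.
  by apply/eqP => e; have := boundH x dx; rewrite e in kxy; rewrite mulSn in kxy; lia.
have zu : psi y != u by apply: contra_neq yw => <-; rewrite psiK.
suff [->|] : y = x \/ adj y x; [by left | by rewrite adj_sym; right |].
apply: card0 => //; rewrite -[y in induced [set~ y]]psiK -(matching_profile_card _ _ _ m zu).
apply: cardP => // z dz kz.
apply: IHG => //; first by rewrite -deg psiK.
by have := shift _ zu; rewrite psiK kxy kz mulSn; lia.
Qed.

(** The M+1 terms of the progression belong to distinct vertices, and [u], at its top, is adjacent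
    to all the others. *)
Lemma exceptional_class_large (r a M : nat) (G H : sgraph) (phi : G -> H) (u : G) :
    matching phi u -> (forall v, degree (phi v) = degree v) -> 0 < a ->
    (forall v, v != u -> clique_degree r (phi v) = clique_degree r v + a) ->
    clique_degree r u = clique_degree r (phi u) + M * a ->
    (forall x : G, degree x != (degree u).+1) -> degree u + 4 <= #|G| ->
  M <= degree u /\ M < #|[set x : G | degree x == degree u]|.
Proof.
move=> m deg a_gt0 shift top gap le_u.
have prof := profile_exceptional m deg a_gt0 shift top gap le_u.
have clq := exceptional_class_clique m deg a_gt0 shift top gap le_u.
have /fin_all_exists[f fP] (j : 'I_M.+1) : exists x : G,
    degree x = degree u /\ clique_degree r x = clique_degree r (phi u) + j * a.
  have /card_gt0P[x] : 0 < profile r (degree u) (clique_degree r (phi u) + j * a) G.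
    by rewrite (prof _).2; case: existsP => // -[]; exists j.
  by rewrite inE => /andP[/eqP dx /eqP kx]; exists x.
have inj_f : injective f.
  move=> i j eq_f; have := (fP j).2; rewrite -eq_f (fP i).2 => /eqP.
  by rewrite eqn_add2l eqn_pmul2r // => /eqP/val_inj.
have large : M < #|[set x : G | degree x == degree u]|.
  rewrite -[M.+1]card_ord -cardsT -(card_imset _ inj_f); apply/subset_leq_card/subsetP.
  by move=> _ /imsetP[j _ ->]; rewrite inE (fP j).1.
split=> //; rewrite -ltnS; apply: (leq_trans large); rewrite (cardsD1 u) inE eqxx ltnS.
apply/subset_leq_card/subsetP => x; rewrite !inE => /andP[xu /eqP dx].
have := profile_gt0 dx (erefl (clique_degree r x)).
rewrite (prof _).2; case: existsP => // -[j /eqP kx _].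
have [||//|xu'|] := (clq (M - j)).1 x u => //; last by rewrite adj_sym.
  rewrite top kx -addnA -mulnDl subnKC // -ltnS; exact: ltn_ord.
by rewrite xu' eqxx in xu.
Qed.

(** * Sparse graphs *)

(** Average degree at most 3n/8 - 10, multiplied by 8n to stay in the natural numbers. *)
Definition sparse (G : sgraph) : Prop :=
  8 * \sum_(v : G) degree v + 80 * #|G| <= 3 * #|G| ^ 2.

Lemma sum_descending (n K : nat) :
  K <= n -> 2 * (\sum_(j < K) (n - j.+1)) + K * K.+1 = 2 * n * K.
Proof.
elim: K => [|K IHK] ltK; first by rewrite big_ord0 !muln0.
rewrite big_ord_recr /=; have := IHK (ltnW ltK).
have : n - K.+1 + K.+1 = n by rewrite subnK.
by move: (n - K.+1) (\sum_(_ < _) _) => p q; nia.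
Qed.

Lemma matching_degree_not_lt (G H : sgraph) (phi : G -> H) (u : G) :
    sparse G -> matching phi u ->
  ~ (forall v, v != u -> degree v < degree (phi v)).
Proof.
move=> sp m lt_deg; have G_gt0 : 0 < #|G| by apply/card_gt0P; exists u.
(* Sparsity alone gives 80n <= 3n^2. *)
have G_gt26 : 26 < #|G| by move: sp; rewrite /sparse; nia.
(* K = (n-4)/2, rounded down, is the largest value allowed by [low_le]; the sum is 3n^2/8 up to a
   linear term. *)
have : \sum_(j < (#|G| - 4)./2) (#|G| - j.+1) <= \sum_(v : G) degree v.
  by apply: leq_sum_degree_low => j le_j; apply: (low_le m lt_deg); lia.
have : (#|G| - 4)./2 <= #|G| by lia.
move/sum_descending; move: sp; rewrite /sparse.
have [l [b [le_b ->]]] : exists l b, b <= 1 /\ #|G| = 2 * l + b + 4.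
  by exists (#|G| - 4)./2, (odd (#|G| - 4)); split; lia.
have -> : (2 * l + b + 4 - 4)./2 = l by lia.
move: (\sum_v _) (\sum_(_ < _) _) => p q.
case: b le_b => [|[|//]] _; nia.
Qed.

Lemma sparse_low_degree (G : sgraph) :
  0 < #|G| -> sparse G -> exists x : G, 8 * degree x <= 3 * #|G|.
Proof.
move=> G_gt0 sp; suff /existsP : [exists x : G, 8 * degree x <= 3 * #|G|] by [].
apply: contraT; rewrite negb_exists => /forallP H.
have : #|G| * (3 * #|G|) <= \sum_(x : G) 8 * degree x.
  by rewrite -sum_nat_const; apply: leq_sum => x _; rewrite ltnW // ltnNge.
rewrite -big_distrr /=; move: sp G_gt0; rewrite /sparse; move: (\sum_v _) #|G| => p n; nia.
Qed.

Lemma sum_ascending (l m : nat) :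
  2 * (\sum_(l <= i < l + m) i) + m = m * (2 * l + m).
Proof.
elim: m => [|m IHm]; first by rewrite [l + 0]addn0 big_geq ?muln0 ?mul0n.
rewrite [l + _]addnS big_nat_recr ?leq_addr //=.
by move: IHm; move: (\sum_(l <= i < l + m) i) => p; nia.
Qed.

Lemma leq_sum_degree_attained (G : sgraph) (l m : nat) :
    (forall i, l <= i < l + m -> exists x : G, degree x = i) ->
  \sum_(l <= i < l + m) i <= \sum_(v : G) degree v.
Proof.
(* Restricting to degrees below l+m makes the vertex chosen for the next degree a new one. *)
move=> att; suff : \sum_(l <= i < l + m) i <= \sum_(v : G | degree v < l + m) degree v.
  by move/leq_trans; apply; rewrite [leqRHS](bigID (fun v : G => degree v < l + m)) leq_addr.
elim: m att => [|m IHm] att; first by rewrite addn0 big_geq.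
rewrite addnS big_nat_recr ?leq_addr //=.
have [|x dx] := att (l + m); first by lia.
rewrite (bigD1 x) ?dx //= addnC leq_add2l.
apply: (leq_trans (IHm _)).
  by move=> i /andP[le_i lt_i]; apply: att; lia.
rewrite [leqLHS]big_mkcond [leqRHS]big_mkcond; apply: leq_sum => v _.
case: ifP => // lt_v; have vx : v != x by apply: contraTneq lt_v => ->; rewrite dx ltnn.
by rewrite vx ltnS (ltnW lt_v).
Qed.

Lemma not_sparse_attained (G : sgraph) :
    0 < #|G| -> sparse G ->
  ~ (forall i, i + 4 <= #|G| -> (exists x : G, degree x = i) ->
       exists x : G, degree x = i.+1).
Proof.
move=> G_gt0 sp step; have [x0 le_x0] := sparse_low_degree G_gt0 sp.
have att i : degree x0 <= i -> i + 3 <= #|G| -> exists x : G, degree x = i.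
  move/subnK <-; elim: (i - _) => [|k IHk] le_k; first by exists x0.
  by rewrite addSn; apply: step; [lia | apply: IHk; lia].
have G_gt26 : 26 < #|G| by move: sp; rewrite /sparse; nia.
(* These are the degrees from n/2 to n-3, all attained since [x0] has degree at most 3n/8; they add
   up to about 3n^2/8. *)
have : \sum_(#|G|./2 <= i < #|G|./2 + (#|G| - 2 - #|G|./2)) i <= \sum_(v : G) degree v.
  by apply: leq_sum_degree_attained => i le_i; apply: att; lia.
have := sum_ascending #|G|./2 (#|G| - 2 - #|G|./2).
move: sp; rewrite /sparse; move: (\sum_v _) (\sum_(_ <= _ < _) _) => p q.
move: #|G| G_gt26 => n n_gt26.
have [l [b [le_b le_l def_n]]] : exists l b, [/\ b <= 1, 2 <= l & n = 2 * l + b].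
  by exists n./2, (odd n); split; lia.
have -> : n./2 = l by lia.
have [c def_l] : exists c, l = c + 2 by exists (l - 2); lia.
have -> : n - 2 - l = c + b by lia.
rewrite def_n def_l => {n_gt26 def_n def_l le_l}; case: b le_b => [|[|//]] _; nia.
Qed.

Lemma matching_clique_count_not_lt (r : nat) (G H : sgraph) (phi : G -> H) (u : G) :
    sparse G -> matching phi u -> (forall v, degree (phi v) = degree v) ->
  ~ clique_count r G < clique_count r H.
Proof.
move=> sp m deg lt_k; have G_gt0 : 0 < #|G| by apply/card_gt0P; exists u.
pose a := clique_count r H - clique_count r G.
have a_gt0 : 0 < a by rewrite subn_gt0.
have kH : clique_count r H = clique_count r G + a by rewrite subnKC // ltnW.
have shift v : v != u -> clique_degree r (phi v) = clique_degree r v + a.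
  by move/(matching_clique_degree r m); rewrite kH; lia.
(* [phi v] lies on at least a > 0 r-cliques and has the degree of [v]. *)
have le_r v : v != u -> r.-1 <= degree v.
  move=> vu; have := @leq_degree_clique r _ (phi v); rewrite shift // deg.
  by rewrite addn_gt0 a_gt0 orbT => /(_ isT); lia.
have sum_r : (#|G| - 1) * r.-1 <= \sum_(v : G) degree v.
  rewrite (bigD1 u) //= subn1 -(cardC1 u) -sum_nat_const.
  by apply: leq_trans (leq_addl _ _); apply: leq_sum.
have r_small : 8 * r + 69 <= 3 * #|G| by move: sp sum_r; rewrite /sparse; nia.
have top : clique_degree r u = clique_degree r (phi u) + (#|G| - 1 - r) * a.
  have := matching_clique_degree_exception r m; rewrite kH.
  have [p ->] : exists p, #|G| - 1 = r + p by exists (#|G| - 1 - r); lia.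
  by rewrite addKn; nia.
apply: (not_sparse_attained G_gt0 sp) => i le_i [x dx].
suff /existsP[y /eqP dy] : [exists y : G, degree y == i.+1] by exists y.
apply: contraT; rewrite negb_exists => /forallP gap.
have [iu | iu] := eqVneq i (degree u); last first.
  by have := no_gap_above m deg a_gt0 shift gap le_i iu x; rewrite dx eqxx.
rewrite iu in gap le_i.
have [le_s lt_class] := exceptional_class_large m deg a_gt0 shift top gap le_i.
(* The class of [u] alone has at least n-r vertices, each of degree at least M = n-1-r. *)
have : (#|G| - r) * (#|G| - 1 - r) <= \sum_(v : G) degree v.
  rewrite (bigID (fun v => degree v == degree u)) /=.
  apply: leq_trans (leq_addr _ _).
  rewrite (eq_bigr (fun=> degree u)) => [|v /eqP //].
  rewrite sum_nat_cond_const leq_mul //; apply: leq_trans _ lt_class; move: #|G| => n; lia.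
move: sp r_small; rewrite /sparse; move: (\sum_v _) #|G| => q n sp r_small.
have [p def_n] : exists p, n = r + p by exists (n - r); lia.
have [k def_p] : exists k, p = k.+1 by exists p.-1; lia.
have -> : n - r = k.+1 by lia.
have -> : n - 1 - r = k by lia.
(* Since r < 3n/8, the product is about 25n^2/64 or more, which exceeds 24n^2/64 = 3n^2/8. *)
have le_n : 5 * n <= 8 * k.+1 by lia.
have := leq_mul le_n le_n; have := leq0n (k * k); have : k < n by lia.
by move: sp; rewrite -mulnn; clear; lia.
Qed.

Lemma matching_clique_count2 (G H : sgraph) (phi : G -> H) (u : G) :
  sparse G -> matching phi u -> clique_count 2 H <= clique_count 2 G.
Proof.
move=> sp m; rewrite leqNgt; apply/negP => lt_k.
apply: (matching_degree_not_lt sp m) => v vu.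
by have := matching_clique_degree 2 m vu; rewrite !clique_degree2; lia.
Qed.

Lemma matching_degree (G H : sgraph) (phi : G -> H) (u : G) :
    matching phi u -> clique_count 2 G = clique_count 2 H ->
  forall v, degree (phi v) = degree v.
Proof.
move=> m eq_k v; have [->|vu] := eqVneq v u.
  by have := matching_clique_degree_exception 2 m; rewrite !clique_degree2 eq_k; lia.
by have := matching_clique_degree 2 m vu; rewrite !clique_degree2 eq_k; lia.
Qed.

(** H has at most as many edges as G, so it is sparse too, and every one-sided bound can be applied
    in both directions. *)
Lemma matching_clique_count (r : nat) (G H : sgraph) (phi : G -> H) (u : G) :
  sparse G -> matching phi u -> clique_count r H = clique_count r G.
Proof.
move=> spG m; have [psi m'] := matching_sym m.
have le2 := matching_clique_count2 spG m.
have spH : sparse H.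
  move: spG; rewrite /sparse -(matching_card m) !sum_degree; apply: leq_trans.
  by rewrite leq_add2r !leq_mul2l le2.
have eq2 : clique_count 2 G = clique_count 2 H.
  by apply/eqP; rewrite eqn_leq le2 (matching_clique_count2 spH m').
case: (ltngtP (clique_count r H) (clique_count r G)) => // lt_k.
  by case: (matching_clique_count_not_lt spH m' (matching_degree m' (esym eq2)) lt_k).
by case: (matching_clique_count_not_lt spG m (matching_degree m eq2) lt_k).
Qed.

(** * From average degree to sparsity, and the theorem *)

Local Open Scope ring_scope.

Lemma avg_degree_sparse (G : sgraph) :
  (0 < #|G|)%N -> avg_degree G <= 3%:R * #|G|%:R / 8%:R - 10%:R -> sparse G.
Proof.
move=> G_gt0; have n_gt0 : 0 < #|G|%:R :> rat by rewrite ltr0n.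
rewrite /avg_degree ler_pdivrMr // /sparse -(ler_nat rat) natrD !natrM.
move: (_%:R : rat) (#|G|%:R : rat) => s n le_s; lra.
Qed.

Theorem theorem1p4 :
  exists C : rat,
    forall (n : nat) (G : sgraph),
      (7 <= n)%N -> #|G| = n ->
      avg_degree G <= 3%:R * n%:R / 8%:R - C ->
      forall r : nat, (1 <= r)%N ->
        reconstructible_from (n - 1)%N (clique_count r) G.
Proof.
(* C = 10 is the slack 80n in [sparse], which absorbs the linear error terms. *)
exists 10%:R => n G n_ge7 cardG; rewrite -cardG in n_ge7 * => le_avg r _ H le_common.
have [|phi [u m]] := common_cards_matching _ le_common; first by lia.
by apply: matching_clique_count m; apply: avg_degree_sparse le_avg; lia.
Qed.
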